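(* Let $\varphi\colon G\to H$ be a surjective homomorphism of finite groups. (1) If $G$ is unramified over a nontrivial abelian normal subgroup $N$ and $M=\varphi(N)$ is nontrivial, then $H$ is unramified over $M$. (2) If $G$ is totally unramified, then $H$ is totally unramified.
   Context: All representations are complex. A representation is multiplicity free if it is a direct sum of pairwise non-equivalent irreducible representations; a restriction $\rho|_N$ is called trivial if every element of $N$ acts as the identity. A finite group $G$ is unramified over a nontrivial abelian normal subgroup $N$ if for every irreducible representation $\rho$ of $G$ the restriction $\rho|_N$ is multiplicity free or trivial. A finite group $G$ is totally unramified (recursively) if it is abelian or there exists a nontrivial abelian normal subgroup $N$ such that $G$ is unramified over $N$ and $G/N$ is totally unramified. *)

(* Defs.v *)
From HB Require Import structures.
From mathcomp Require Import all_boot all_order all_algebra all_fingroup all_solvable all_character.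
From mathcomp Require Import complex reals.

Set Implicit Arguments.
Unset Strict Implicit.
Unset Printing Implicit Defensive.

Import GroupScope GRing.Theory.
Local Open Scope ring_scope.

(* Internal direct sum: submodules are given, up to [:=:], by matrices whose
   row space is the subspace; [mxsimple] submodules are nonzero. *)
Definition multiplicity_free (F : fieldType) (gT : finGroupType)
    (G : {group gT}) (n : nat) (rG : mx_representation F G n) : Prop :=
  exists (k : nat) (U : 'I_k -> 'M[F]_n),
    [/\ forall i, mxsimple rG (U i),
        forall i j, i != j -> ~ mx_iso rG (U i) (U j),
        mxdirect (\sum_(i < k) U i)
      & (\sum_(i < k) U i :=: 1%:M)%MS].

Definition trivial_repr (F : fieldType) (gT : finGroupType)
    (G : {group gT}) (n : nat) (rG : mx_representation F G n) : Prop :=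
  {in G, forall x, rG x = 1%:M}.

(* The inclusion [sNG] is quantified only because [subg_repr] takes it as an
   argument; it always holds, by the first clause. *)
Definition unramified_over (F : fieldType) (gT : finGroupType)
    (G N : {group gT}) : Prop :=
  [/\ N <| G, abelian N, N :!=: 1%g
    & forall (sNG : N \subset G) (n : nat) (rG : mx_representation F G n),
        mx_irreducible rG ->
        multiplicity_free (subg_repr rG sNG) \/ trivial_repr (subg_repr rG sNG)].

Inductive totally_unramified (F : fieldType) :
    forall gT : finGroupType, {group gT} -> Prop :=
| totally_unramified_abelian (gT : finGroupType) (G : {group gT}) :
    abelian G -> totally_unramified F G
| totally_unramified_quotient (gT : finGroupType) (G N : {group gT}) :
    unramified_over F G N -> totally_unramified F (G / N)%G ->
    totally_unramified F G.

(* Main.v *)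
Require Import Defs.
From HB Require Import structures.
From mathcomp Require Import all_boot all_order all_algebra all_fingroup all_solvable all_character.
From mathcomp Require Import complex reals.

Set Implicit Arguments.
Unset Strict Implicit.
Unset Printing Implicit Defensive.

Import GroupScope GRing.Theory.
Local Open Scope ring_scope.

(** A representation of [phi @* G] pulls back to one of [G] given by the same
    matrices, hence with the same submodules and the same module isomorphisms;
    this gives (1).  For (2), induct on total unramifiedness: if [phi @* N] is
    trivial then [phi] factors through [G / N], otherwise (1) applies and
    [(phi @* G) / (phi @* N)] is an image of [G / N]. *)

Section Pullback.

(* Only the values of [rG] are constrained, rather than [rG] being taken to be
   [morphim_repr rH sGD]: restricting a pullback and pulling back a restriction
   are representations that agree in values but not in proof components. *)
Variables (F : fieldType) (aT rT : finGroupType) (G D : {group aT}).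
Variables (f : {morphism D >-> rT}) (sGD : G \subset D) (n : nat).
Variables (rG : mx_representation F G n) (rH : mx_representation F (f @* G) n).
Hypothesis rGE : {in G, forall x, rG x = rH (f x)}.

Lemma mxmodule_pullback m (U : 'M[F]_(m, n)) : mxmodule rG U = mxmodule rH U.
Proof.
apply/mxmoduleP/mxmoduleP => modU.
  by move=> _ /morphimP[x _ Gx ->]; rewrite -rGE // modU.
by move=> x Gx; rewrite rGE // modU // mem_morphim ?(subsetP sGD).
Qed.

Lemma mxsimple_pullback (U : 'M[F]_n) : mxsimple rG U <-> mxsimple rH U.
Proof.
rewrite /mxsimple mxmodule_pullback.
by split=> -[modU ntU minU]; split=> // V modV; apply: minU;
  rewrite mxmodule_pullback in modV *.
Qed.

(** By [hom_mxP], each side says that [g] commutes on [U] with every matrix of the representation,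
    and the two representations have the same set of matrices. *)
Lemma dom_hom_mx_pullback m (g : 'M[F]_n) (U : 'M[F]_(m, n)) :
  (U <= dom_hom_mx rG g)%MS = (U <= dom_hom_mx rH g)%MS.
Proof.
apply/hom_mxP/hom_mxP => homUg.
  by move=> _ /morphimP[x _ Gx ->]; rewrite -rGE // homUg.
by move=> x Gx; rewrite rGE // homUg // mem_morphim ?(subsetP sGD).
Qed.

Lemma mx_iso_pullback (U V : 'M[F]_n) : mx_iso rG U V <-> mx_iso rH U V.
Proof.
by split=> -[g g_unit homUg defV]; exists g => //;
  move: homUg; rewrite dom_hom_mx_pullback.
Qed.

Lemma multiplicity_free_pullback :
  multiplicity_free rG <-> multiplicity_free rH.
Proof.
split=> -[k [U [simU isoU dxU sumU]]]; exists k, U; split=> //.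
- by move=> i; apply/mxsimple_pullback; apply: simU.
- by move=> i j neq_ij /mx_iso_pullback; apply: isoU.
- by move=> i; apply/mxsimple_pullback; apply: simU.
- by move=> i j neq_ij /mx_iso_pullback; apply: isoU.
Qed.

Lemma trivial_repr_pullback : trivial_repr rG <-> trivial_repr rH.
Proof.
split=> triv; first by move=> _ /morphimP[x _ Gx ->]; rewrite -rGE // triv.
by move=> x Gx; rewrite rGE // triv // mem_morphim ?(subsetP sGD).
Qed.

End Pullback.

Lemma unramified_over_morphim (F : fieldType) (aT rT : finGroupType)
    (G N : {group aT}) (phi : {morphism G >-> rT}) :
  unramified_over F G N -> phi @* N != 1%g ->
  unramified_over F (phi @* G)%G (phi @* N)%G.
Proof.
move=> [nsNG abN _ unrGN] ntM; split=> //.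
- exact: morphim_normal.
- exact: morphim_abelian.
move=> sMH n rH irrH; have sNG := normal_sub nsNG.
have irrG : mx_irreducible (morphim_repr rH (subxx G)) by apply/morphim_mx_irr.
(* Both sides compute to [rH (phi x)]. The pullback lemmas are then applied to the group [N] inside
   the larger domain [G] of [phi]. *)
have resE : {in N, forall x,
    subg_repr (morphim_repr rH (subxx G)) sNG x = subg_repr rH sMH (phi x)} by [].
case: (unrGN sNG n _ irrG) => [mfN | trivN]; [left | right].
  exact/(multiplicity_free_pullback sNG resE).
exact/(trivial_repr_pullback sNG resE).
Qed.

(** Target and morphism are quantified after the hypothesis, so that the induction hypothesis covers
    every morphism out of [G / N], in particular the two induced by [phi]. *)
Lemma totally_unramified_morphim (F : fieldType) (aT : finGroupType)
    (G : {group aT}) :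
  totally_unramified F G ->
  forall (rT : finGroupType) (phi : {morphism G >-> rT}),
    totally_unramified F (phi @* G)%G.
Proof.
elim=> {aT G} [aT G abG | aT G N unrGN _ IH] rT phi.
  by apply: totally_unramified_abelian; apply: morphim_abelian.
have [nsNG _ _ _] := unrGN; have [sNG nNG] := andP nsNG.
have [M1 | ntM] := eqVneq (phi @* N) 1%g.
  have sKK : 'ker (coset N) \subset 'ker phi.
    by rewrite ker_coset -sub_morphim_pre // M1.
  have <- : (factm_morphism sKK nNG @* (G / N))%G = (phi @* G)%G.
    by apply: val_inj; apply: morphim_factm.
  exact: IH.
apply: totally_unramified_quotient (unramified_over_morphim unrGN ntM) _.
have <- : (quotm_morphism phi nsNG @* (G / N))%G = (phi @* G / phi @* N)%G.
  by apply: val_inj; apply: morphim_quotm.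
exact: IH.
Qed.

(* Over the complex numbers R[i], for R a model of the real numbers. *)
Theorem proposition5p4 (R : realType) (aT rT : finGroupType)
    (G : {group aT}) (H : {group rT}) (phi : {morphism G >-> rT})
    (phi_surj : phi @* G = H) :
  (forall N : {group aT},
     unramified_over R[i]%C G N -> phi @* N != 1%g ->
     unramified_over R[i]%C H (phi @* N)%G)
  /\ (totally_unramified R[i]%C G -> totally_unramified R[i]%C H).
Proof.
(* [phi_surj] equates sets; replacing [H] requires an equality of groups. *)
have <- : (phi @* G)%G = H by apply: val_inj.
split=> [N | /totally_unramified_morphim]; last exact.
exact: unramified_over_morphim.
Qed.
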